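(* Let $q$ be an odd prime power and $n\ge 1$. Let $A\subseteq\mathbb{F}_q^n$ be such that there do not exist three distinct elements $x,y,z\in A$ with $\langle z-x,y-x\rangle=0$. Then $|A|\le\binom{n+q}{q-1}+3$.
   Context: $\langle u,v\rangle=\sum_{i=1}^n u_iv_i\in\mathbb{F}_q$ denotes the standard bilinear inner product on $\mathbb{F}_q^n$. *)

(* Defs.v *)
(* MathComp. *)
From HB Require Import structures.
From mathcomp Require Import all_boot all_order all_algebra.

Set Implicit Arguments.
Unset Strict Implicit.
Unset Printing Implicit Defensive.

Import GRing.Theory.
Local Open Scope ring_scope.

Definition dotp (F : fieldType) (n : nat) (u v : 'rV[F]_n) : F :=
  \sum_(i < n) u 0 i * v 0 i.

(* The condition is not symmetric in x, y, z: the right angle is at x. *)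
Definition right_angle_free (F : finFieldType) (n : nat) (A : {set 'rV[F]_n}) :
  Prop :=
  ~ (exists x y z : 'rV[F]_n,
       [/\ x \in A, y \in A & z \in A] /\
       [/\ x != y, y != z & x != z] /\
       dotp (z - x) (y - x) = 0).

(* Main.v *)
(* Write d = q - 1 and G(x; y, z) = 1 - <z - x, y - x>^d.  By Fermat, for x in A
   and y != z in A, G(x; y, z) is 1 if x is y or z, and 0 otherwise.  On the
   other hand <z - x, y - x> is a linear form in (1, <x, x>, x), so as a function
   of x, G(.; y, z) lies in the span of the degree d monomials in n + 2
   quantities, of which there are 'C(n + q, q - 1).  As 2 is invertible, the
   functions e_y + e_z with y != z span all functions on A once |A| >= 3. *)
Require Import Defs.
From mathcomp Require Import all_boot all_order all_algebra all_field ring.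

Set Implicit Arguments.
Unset Strict Implicit.
Unset Printing Implicit Defensive.

Import GRing.Theory.

Section DotProduct.
Local Open Scope ring_scope.
Variable F : fieldType.

Lemma dotpE n (u v : 'rV[F]_n) : dotp u v = (u *m v^T) 0 0.
Proof. by rewrite mxE; apply: eq_bigr => i _; rewrite mxE. Qed.

Lemma dotpC n (u v : 'rV[F]_n) : dotp u v = dotp v u.
Proof. by apply: eq_bigr => i _; rewrite mulrC. Qed.

Lemma dotpDl n (u v w : 'rV[F]_n) : dotp (u + v) w = dotp u w + dotp v w.
Proof. by rewrite !dotpE mulmxDl mxE. Qed.

Lemma dotpNl n (u w : 'rV[F]_n) : dotp (- u) w = - dotp u w.
Proof. by rewrite !dotpE mulNmx mxE. Qed.

Lemma dotpDr n (u v w : 'rV[F]_n) : dotp w (u + v) = dotp w u + dotp w v.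
Proof. by rewrite dotpC dotpDl !(dotpC w). Qed.

Lemma dotpNr n (u w : 'rV[F]_n) : dotp w (- u) = - dotp w u.
Proof. by rewrite dotpC dotpNl (dotpC w). Qed.

Lemma dotp0l n (u : 'rV[F]_n) : dotp 0 u = 0.
Proof. by rewrite dotpE mul0mx mxE. Qed.

Lemma dotp_row_mx m n (u u' : 'rV[F]_m) (v v' : 'rV[F]_n) :
  dotp (row_mx u v) (row_mx u' v') = dotp u u' + dotp v v'.
Proof. by rewrite !dotpE tr_row_mx mul_row_col mxE. Qed.

Lemma dotp_scalar_mx (a b : F) : dotp (a%:M : 'rV_1) b%:M = a * b.
Proof. by rewrite dotpE tr_scalar_mx -scalar_mxM mxE. Qed.

Lemma dotp_exp n d (u v : 'rV[F]_n) :
  dotp u v ^+ d =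
  \sum_(f : {ffun 'I_d -> 'I_n}) (\prod_i u 0 (f i)) * \prod_i v 0 (f i).
Proof.
rewrite -[d in LHS]card_ord -prodr_const /dotp bigA_distr_bigA.
by apply: eq_bigr => f _; rewrite big_split.
Qed.

(** A sorted tuple lists the variables of a monomial with multiplicity, so each degree [d] monomial
    in [n.+1] variables occurs exactly once. *)
Definition monomials d n :=
  [set t : d.-tuple 'I_n.+1 | sorted leq (map val t)].

(** Expanding the power gives one product per index function [f]; by commutativity, sorting the
    values of [f] turns it into a listed monomial. *)
Lemma sum_dotp_exp_eq0 (I : finType) n d (c : I -> F) (u : I -> 'rV[F]_n.+1) :
  (forall t : d.-tuple 'I_n.+1, t \in monomials d n ->
     \sum_i c i * \prod_(k <- t) u i 0 k = 0) ->
  forall w, \sum_i c i * dotp (u i) w ^+ d = 0.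
Proof.
move=> c0 w; under eq_bigr do rewrite dotp_exp mulr_sumr.
rewrite exchange_big big1 //= => f _.
under eq_bigr do rewrite mulrA.
rewrite -mulr_suml; apply/eqP; rewrite mulf_eq0; apply/orP; left; apply/eqP.
pose r : rel 'I_n.+1 := fun i j => (i <= j)%N.
pose t := [tuple of sort r [tuple f i | i < d]].
have tM : t \in monomials d n.
  rewrite inE sorted_map; apply: sort_sorted => i j; exact: leq_total.
rewrite -[RHS](c0 t tM); apply: eq_bigr => i _; congr (_ * _).
rewrite (perm_big [tuple f i | i < d]) ?perm_sort // big_tuple.
by apply: eq_bigr => k _; rewrite tnth_mktuple.
Qed.

(** The matrix [V] evaluates each monomial at each [u i]. A relation among its rows kills all
    monomials, hence all [d]-th powers of linear forms, so it is trivial and the rank is [#|I|]. *)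
Lemma card_le_monomials (I : finType) n d (u : I -> 'rV[F]_n.+1) :
  (forall c : I -> F,
     (forall w, \sum_i c i * dotp (u i) w ^+ d = 0) -> c =1 fun=> 0) ->
  (#|I| <= 'C(d + n, d))%N.
Proof.
move=> inj_u; rewrite -card_sorted_tuples -/(monomials d n).
pose V := \matrix_(i < #|I|, j < #|monomials d n|)
  \prod_(k <- enum_val j) u (enum_val i) 0 k.
suffices: row_free V by move/eqP <-; apply: rank_leq_col.
apply: inj_row_free => c cV0.
suffices c0 : (fun i => c 0 (enum_rank i)) =1 fun=> 0.
  by apply/rowP=> i; rewrite mxE -(c0 (enum_val i)) enum_valK.
apply: inj_u; apply: sum_dotp_exp_eq0 => t tM.
have /rowP/(_ (enum_rank_in tM t)) := cV0; rewrite !mxE; apply: etrans.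
rewrite (reindex _ (onW_bij _ (@enum_val_bij I))).
by apply: eq_bigr => i _; rewrite mxE enum_valK enum_rankK_in.
Qed.

(** The extra coordinates 1 and [dotp x x] absorb the constant and quadratic terms in [x] of
    [dotp (z - x) (y - x)]. *)
Definition lift_vec n (x : 'rV[F]_n) : 'rV[F]_(1 + (1 + n)) :=
  row_mx (1%:M : 'rV_1) (row_mx ((dotp x x)%:M : 'rV_1) x).

Lemma dotp_lift_vec n (x y z : 'rV[F]_n) :
  dotp (lift_vec x)
       (row_mx ((dotp z y)%:M : 'rV_1) (row_mx (1%:M : 'rV_1) (- (y + z))))
  = dotp (z - x) (y - x).
Proof.
rewrite /lift_vec !dotp_row_mx !dotp_scalar_mx !(dotpDl, dotpDr, dotpNl, dotpNr).
by rewrite (dotpC z x); ring.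
Qed.

(** This makes the constant 1 a power of a linear form in the lift, of any degree. *)
Lemma dotp_lift_vec1 n (x : 'rV[F]_n) :
  dotp (lift_vec x) (row_mx (1%:M : 'rV_1) 0) = 1.
Proof.
by rewrite /lift_vec dotp_row_mx dotp_scalar_mx dotpC dotp0l addr0 mulr1.
Qed.

End DotProduct.

Section FiniteField.
Local Open Scope ring_scope.
Variable F : finFieldType.

(** Translation by 1 permutes [F], so adding [#|F|] ones leaves the sum of all elements
    unchanged. *)
Lemma natr_card_finField : #|F|%:R = 0 :> F.
Proof.
apply: (@addrI _ (\sum_(x : F) x)); rewrite addr0 [RHS](reindex_inj (addIr 1)).
by rewrite big_split sumr_const.
Qed.

Lemma odd_card_neq0 : odd #|F| -> 2 != 0 :> F.
Proof.
move=> oddF; apply/eqP => F2; have := natr_card_finField.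
rewrite -(odd_double_half #|F|) oddF natrD -muln2 natrM F2 mulr0 addr0.
by move/eqP; rewrite oner_eq0.
Qed.

Lemma expf_card_pred (x : F) : x != 0 -> x ^+ #|F|.-1 = 1.
Proof.
move=> x0; apply: (mulfI x0).
by rewrite -exprS (ltn_predK (finNzRing_gt1 F)) mulr1 expf_card.
Qed.

Lemma right_angle_free_weights n (A : {set 'rV[F]_n})
    (c : {x | x \in A} -> F) :
  odd #|F| -> right_angle_free A ->
  (forall w, \sum_x c x * dotp (lift_vec (val x)) w ^+ #|F|.-1 = 0) ->
  forall y z, y != z -> c y + c z = 0.
Proof.
move=> oddF hA c0 y z yz.
pose D (x : {x | x \in A}) := dotp (val z - val x) (val y - val x).
have card_gt1 : (0 < #|F|.-1)%N by rewrite -subn1 subn_gt0 finNzRing_gt1.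
(* Both 1 and [D x ^+ #|F|.-1] are powers of linear forms in the lift, so [c0] applies to each. *)
have : \sum_x c x * (1 - D x ^+ #|F|.-1) = 0.
  under eq_bigr do rewrite mulrBr.
  rewrite sumrB.
  have := c0 (row_mx (1%:M : 'rV_1) 0).
  under eq_bigr do rewrite dotp_lift_vec1 expr1n.
  move=> ->; rewrite sub0r; apply/eqP; rewrite oppr_eq0; apply/eqP.
  rewrite -[RHS](c0 (row_mx ((dotp (val z) (val y))%:M : 'rV_1)
                  (row_mx (1%:M : 'rV_1) (- (val y + val z))))).
  by apply: eq_bigr => x _; rewrite dotp_lift_vec.
have Dy : D y = 0 by rewrite /D subrr dotpC dotp0l.
have Dz : D z = 0 by rewrite /D subrr dotp0l.
(* Only the terms at [y] and [z] survive: any other [x] has [D x] nonzero, since [D x = 0] would be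
   a right angle at [x]. *)
rewrite (bigD1 y) //= (bigD1 z) 1?eq_sym //= Dy Dz.
rewrite expr0n gtn_eqF // subr0 !mulr1.
rewrite big1 ?addr0 // => x /andP[xy xz].
rewrite expf_card_pred ?subrr ?mulr0 //.
apply/eqP => Dx; apply: hA; exists (val x), (val y), (val z).
by split; [split; exact: valP | split].
Qed.

End FiniteField.

Theorem theorem5 (q n : nat) (F : finFieldType) (A : {set 'rV[F]_n})
    (hF : #|F| = q) (hq : odd q) (hn : 1 <= n)
    (hA : right_angle_free A) :
  #|A| <= 'C(n + q, q.-1) + 3.
Proof.
subst q; have [A_le2 | A_gt2] := leqP #|A| 2.
  exact: leq_trans A_le2 (leq_trans _ (leq_addl _ _)).
apply: leq_trans (leq_addr _ _).
have F_gt0 := ltnW (finNzRing_gt1 F).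
(* The lift has [n.+2] coordinates, so the monomial count is used with [n.+1]. *)
have -> : n + #|F| = #|F|.-1 + n.+1 by rewrite addnS -addSn prednK // addnC.
rewrite -card_sig in A_gt2 *.
apply: (card_le_monomials (u := fun x : {x | x \in A} => lift_vec (val x))).
move=> c c0 y; have cD := right_angle_free_weights hq hA c0.
have /card_gt0P[z zP] : 0 < #|predC1 y|.
  by rewrite cardC1 -subn1 subn_gt0 ltnW.
have /card_gt0P[w] : 0 < #|[predD1 (predC1 y) & z]|.
  have := cardD1 z (predC1 y); rewrite zP cardC1 => cardA.
  by move: A_gt2; rewrite -ltn_predRL cardA add1n ltnS.
rewrite !inE => /andP[wz wy]; rewrite inE in zP.
(* With three distinct points, pairwise sums determine [2 * c y], and 2 is invertible in odd
   order. *)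
have cy2 : (2 * c y = (c y + c z) + (c y + c w) - (c z + c w))%R by ring.
move: cy2; rewrite !cD 1?eq_sym // addr0 subr0 => /eqP.
by rewrite mulf_eq0 (negPf (odd_card_neq0 hq)) => /eqP.
Qed.
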